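(* Let $Y$ be a complex Banach space, let $c\in\mathbb{C}$ with $|c|=1$, and let $\emptyset\neq I\subseteq\mathbb{R}^n$ be a closed set with $I+I=I$. For $M>0$ put $I_M:=\{\mathbf{t}\in I:|\mathbf{t}|\ge M\}$. Assume that: (1) for every $l>0$ and every $M>0$ there exist $\mathbf{t}_0\in I$ and $k>0$ such that for every $\mathbf{t}\in I_{M+l}$ there exists $\mathbf{t}_0'\in I$ such that for every $\mathbf{t}_0''\in B(\mathbf{t}_0',l)\cap I$ we have $\mathbf{t}-\mathbf{t}_0''\in B(\mathbf{t}_0,kl)\cap I_M$; (2) there exists $L>0$ such that $I_{kL}\setminus I_{(k+1)L}\neq\emptyset$ for all $k\in\mathbb{N}$; (3) $I_M+I\subseteq I_M$ for all $M>0$. If $F:I\to Y$ is a uniformly continuous, bounded, $I$-asymptotically Bohr $c$-almost periodic function of type $1$, then $F$ is $I$-asymptotically Bohr $c$-almost periodic.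
   Context: Here $n\in\mathbb{N}=\{1,2,\dots\}$, $|\cdot|$ is the Euclidean norm on $\mathbb{R}^n$ and $B(\mathbf{t}_0,l):=\{\mathbf{t}\in\mathbb{R}^n:|\mathbf{t}-\mathbf{t}_0|\le l\}$. Let $I\subseteq\mathbb{R}^n$ be unbounded with $I+I\subseteq I$, and let $F:I\to Y$ be continuous. $F$ is $I$-asymptotically Bohr $c$-almost periodic of type $1$ if for every $\epsilon>0$ there exist $l>0$ and $M>0$ such that for each $\mathbf{t}_0\in I$ there exists $\tau\in B(\mathbf{t}_0,l)\cap I$ such that $\|F(\mathbf{t}+\tau)-cF(\mathbf{t})\|_Y\le\epsilon$ whenever $\mathbf{t}\in I_M$ and $\mathbf{t}+\tau\in I_M$. A continuous function $G:I\to Y$ is Bohr $c$-almost periodic if for every $\epsilon>0$ there exists $l>0$ such that for each $\mathbf{t}_0\in I$ there exists $\tau\in B(\mathbf{t}_0,l)\cap I$ such that $\|G(\mathbf{t}+\tau)-cG(\mathbf{t})\|_Y\le\epsilon$ for all $\mathbf{t}\in I$. $F$ is $I$-asymptotically Bohr $c$-almost periodic if $F=G+Q$ on $I$, where $G:I\to Y$ is Bohr $c$-almost periodic and $Q:I\to Y$ is continuous with $\lim_{|\mathbf{t}|\to+\infty,\ \mathbf{t}\in I}Q(\mathbf{t})=0$. *)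

(* Defs.v *)
From HB Require Import structures.
From mathcomp Require Import all_boot all_order all_algebra.
From mathcomp Require Import complex.
From mathcomp Require Import all_classical all_reals all_analysis.

Set Implicit Arguments.
Unset Strict Implicit.
Unset Printing Implicit Defensive.

Import Order.TTheory GRing.Theory Num.Theory.
Import numFieldNormedType.Exports.

Local Open Scope classical_set_scope.
Local Open Scope ring_scope.
Local Open Scope complex_scope.

Section EuclideanSpace.
Context {R : realType} {n : nat}.
Implicit Types (t : 'rV[R]_n) (I : set 'rV[R]_n).

(* The library norm on 'rV[R]_n is the sup norm; it induces the usual topology
   and uniformity, but balls and the sets I_M below are Euclidean. *)
Definition enorm t : R := Num.sqrt (\sum_(i < n) t 0 i ^+ 2).

Definition eball t0 (l : R) : set 'rV[R]_n := [set t | enorm (t - t0) <= l].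

Definition outer I (M : R) : set 'rV[R]_n := [set t | I t /\ M <= enorm t].

Definition setsum I J : set 'rV[R]_n := [set s + t | s in I & t in J].

Definition enorm_infty : set_system 'rV[R]_n :=
  filter_from [set M : R | 0 < M] (fun M => [set t | M <= enorm t]).

Global Instance enorm_infty_filter : Filter enorm_infty.
Proof.
apply: filter_from_filter; first by exists 1; rewrite /= ltr01.
move=> M N /= M0 N0; exists (Num.max M N); first by rewrite /= lt_max M0.
by move=> t /=; rewrite ge_max => /andP[].
Qed.

End EuclideanSpace.

(* A map I -> Y is a total map restricted to I: only its values on I matter,
   and continuity is with respect to the subspace topology of I. Since norms on
   Y are R[i]-valued, a real bound e is written e%:C. *)
Section AlmostPeriodic.
Context {R : realType} {n : nat} {Y : completeNormedModType R[i]}.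
Variables (c : R[i]) (I : set 'rV[R]_n).
Implicit Types F G Q : 'rV[R]_n -> Y.

Definition uniformly_continuous_on F : Prop :=
  unif_continuous (F : subspace I -> Y).

Definition asymptotically_Bohr_ap_type1 F : Prop :=
  {within I, continuous F} /\
  forall e : R, 0 < e -> exists l M : R, [/\ 0 < l, 0 < M &
    forall t0, I t0 -> exists2 tau, (eball t0 l `&` I) tau &
      forall t, outer I M t -> outer I M (t + tau) ->
        `|F (t + tau) - c *: F t| <= e%:C].

Definition Bohr_ap G : Prop :=
  {within I, continuous G} /\
  forall e : R, 0 < e -> exists2 l : R, 0 < l &
    forall t0, I t0 -> exists2 tau, (eball t0 l `&` I) tau &
      forall t, I t -> `|G (t + tau) - c *: G t| <= e%:C.

Definition asymptotically_Bohr_ap F : Prop :=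
  exists G Q, [/\ Bohr_ap G, {within I, continuous Q},
    Q t @[t --> within I enorm_infty] --> (0 : Y) &
    forall t, I t -> F t = G t + Q t].

End AlmostPeriodic.

(* Main.v *)
(* Pick points s_k of I with |s_k| >= k that are almost periods of F for the
   precision 1/(k+1). By (1) and uniform continuity the translates of F form a
   totally bounded family for the sup norm on I, so along an ultrafilter on the
   indices F(. + s_k) converges uniformly on I to some H. Then G := c^-1 H is
   Bohr c-almost periodic, since by (3) adding s_k pushes all of I into the
   region where the almost-period estimates of F hold, and F - G vanishes at
   infinity because F(. + s_k) is close to c F far away. Passing to an
   ultrafilter replaces the extraction of a subsequence. *)
Require Import Defs.
From HB Require Import structures.
From mathcomp Require Import all_boot all_order all_algebra.
From mathcomp Require Import complex.
From mathcomp Require Import all_classical all_reals all_analysis.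
From mathcomp Require Import ring.

Set Implicit Arguments.
Unset Strict Implicit.
Unset Printing Implicit Defensive.

Import Order.TTheory GRing.Theory Num.Theory.
Import numFieldNormedType.Exports.

Local Open Scope classical_set_scope.
Local Open Scope ring_scope.
Local Open Scope complex_scope.

Lemma mx_norm_le_enorm (R : realType) (n : nat) (t : 'rV[R]_n) :
  `|t| <= enorm t.
Proof.
rewrite [`|t|]mx_normrE; apply: bigmax_le; first exact: sqrtr_ge0.
move=> [i j] _ /=; rewrite ord1 -sqrtr_sqr ler_wsqrtr//.
by rewrite (bigD1 j)//= lerDl sumr_ge0// => k _; exact: sqr_ge0.
Qed.

Lemma enorm_le_mx_norm (R : realType) (n : nat) (t : 'rV[R]_n) :
  enorm t <= n%:R * `|t|.
Proof.
rewrite -[leRHS]ger0_norm ?mulr_ge0// -sqrtr_sqr ler_wsqrtr//.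
apply: (@le_trans _ _ (\sum_(i < n) `|t| ^+ 2)).
  apply: ler_sum => i _; rewrite -[leLHS]real_normK ?num_real// lerXn2r ?nnegrE//.
  by rewrite [`|t|]mx_normrE (le_bigmax _ (fun ij => `|t ij.1 ij.2|) (0, i)).
rewrite sumr_const card_ord exprMn -[leLHS]mulr_natl.
apply: ler_wpM2r; first exact: sqr_ge0.
by rewrite -natrX ler_nat; case: n {t} => // n; rewrite leq_pmulr.
Qed.

Lemma gt0_complexE (R : realType) (e : R[i]) :
  0 < e -> exists2 r : R, 0 < r & e = r%:C.
Proof.
by case: e => a b; rewrite ltcE /= => /andP[/eqP -> a0]; exists a.
Qed.

Lemma unif_continuous_on_norm (R : realType) (n : nat)
    (Y : completeNormedModType R[i]) (I : set 'rV[R]_n) (F : 'rV[R]_n -> Y) :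
  uniformly_continuous_on I F -> forall e : R, 0 < e ->
  exists2 d : R, 0 < d & forall s t, I s -> I t -> `|s - t| < d ->
    `|F s - F t| <= e%:C.
Proof.
move=> Fuc e e0; have e0' : 0 < e%:C by rewrite ltcR.
have [W entW WF] := Fuc _ (entourage_ball Y (PosNum e0')).
move: entW; rewrite -entourage_ballE => -[d d0 dW].
exists d => // s t Is It std; apply/ltW.
have := WF (s, t); rewrite /= -ball_normE/=; apply.
by right; do 2 split => //; apply: dW; rewrite /= -ball_normE.
Qed.

(** Closed balls are compact, so the image of [V] under [u] clusters at some [p]; being an
    ultrafilter, it converges to [p]. *)
Lemma ultra_bounded_cauchy (R : realType) (n : nat) (T : Type)
    (V : set_system T) (u : T -> 'rV[R]_n) (r : R) : UltraFilter V ->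
  (\forall k \near V, `|u k| <= r) ->
  forall d : R, 0 < d -> exists p, \forall k \near V, `|p - u k| < d.
Proof.
move=> VU ur d d0.
have [||p [_ clp]] := @bounded_closed_compact R n [set t | `|t| <= r] _ _
  (u @ V) _ ur.
- by exists r; split; [exact: num_real|move=> x rx t /= /le_trans; apply; exact: ltW].
- apply: (@closed_comp _ _ (fun t : 'rV[R]_n => `|t|) [set x | x <= r]).
    by move=> x _; exact: norm_continuous.
  exact: closed_le.
exists p; have [//|pV] := in_ultra_setVsetC [set k | `|p - u k| < d] VU.
have [|q [+ /=]] := clp (~` ball p d) (ball p d) _ (nbhsx_ballx _ _ d0).
  by rewrite /= /fmap/=; apply: filterS pV => k; rewrite /= -ball_normE.
by [].
Qed.

(** An almost period within [l] of a point of norm at least [r + l] has norm at least [r]. By [I_M],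
    adding it never leaves the outer region. *)
Lemma enorm_unbounded_almost_period (R : realType) (n : nat)
    (Y : completeNormedModType R[i]) (c : R[i]) (I : set 'rV[R]_n)
    (F : 'rV[R]_n -> Y) :
  (forall r : R, exists2 t, I t & r <= `|t|) ->
  (forall M : R, 0 < M -> setsum (outer I M) I `<=` outer I M) ->
  asymptotically_Bohr_ap_type1 c I F ->
  forall e r : R, 0 < e -> exists s, [/\ I s, r <= enorm s &
    exists2 M : R, 0 < M & forall t, outer I M t ->
      `|F (t + s) - c *: F t| <= e%:C].
Proof.
move=> Iunb I_M [_ Fap] e r e0; have [l [M [l0 M0 FlM]]] := Fap _ e0.
have [t0 It0 t0r] := Iunb (r + l); have [s [/= st0 Is] Fs] := FlM _ It0.
exists s; split => //; last first.
  by exists M => // t It; apply: Fs => //; apply: I_M => //; exists t => //; exists s.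
apply: le_trans (mx_norm_le_enorm s); rewrite -(lerD2r l) (le_trans t0r)//.
rewrite -[t0 in leLHS](subKr s) (le_trans (ler_normB _ _))// lerD2l.
exact: le_trans (mx_norm_le_enorm _) st0.
Qed.

Lemma translates_cauchy (R : realType) (n : nat)
    (Y : completeNormedModType R[i]) (c : R[i]) (c1 : `|c| = 1)
    (I : set 'rV[R]_n)
    (H1 : forall l M : R, 0 < l -> 0 < M ->
       exists (t0 : 'rV[R]_n) (k : R), [/\ I t0, 0 < k &
         forall t, outer I (M + l) t ->
           exists2 t0', I t0' &
             forall t0'', (eball t0' l `&` I) t0'' ->
               (eball t0 (k * l) `&` outer I M) (t - t0'')])
    (H3 : forall M : R, 0 < M -> setsum (outer I M) I `<=` outer I M)
    (F : 'rV[R]_n -> Y) (F_uc : uniformly_continuous_on I F)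
    (F_ap : asymptotically_Bohr_ap_type1 c I F)
    (T : Type) (V : set_system T) (VU : UltraFilter V) (s : T -> 'rV[R]_n)
    (Is : forall k, I (s k))
    (s_infty : forall M : R, \forall k \near V, M <= enorm (s k)) :
  forall e : R, 0 < e -> exists j, \forall k \near V, forall x, I x ->
    `|F (x + s j) - F (x + s k)| <= e%:C.
(* By (1), a far point s k is tau + u with tau an almost period and u in a fixed
   ball, so the translate of F by s k is uniformly close to c times its
   translate by u; the points u converge along the ultrafilter. *)
Proof.
move=> e e0; have e30 : 0 < e / 3 by rewrite divr_gt0.
have [_ Fap] := F_ap; have [l [M [l0 M0 FlM]]] := Fap _ e30.
have [t0 [r [It0 r0 H]]] := H1 _ _ l0 M0.
have [d d0 Fd] := unif_continuous_on_norm F_uc e30.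
have outerD x y : outer I M x -> I y -> outer I M (x + y).
  by move=> Mx Iy; apply: H3 => //; exists x => //; exists y.
have near_ball k : exists u, M + l <= enorm (s k) ->
    [/\ outer I M u, `|u| <= `|t0| + r * l &
      forall x, I x -> `|F (x + s k) - c *: F (x + u)| <= (e / 3)%:C].
  (* Only far points [s k] matter: for the others the claim is vacuous and 0 is a dummy value. *)
  have [sk|] := pselect (M + l <= enorm (s k)); last by exists 0.
  have [t0' It0' Ht0'] := H _ (conj (Is k) sk).
  have [tau ttau Ftau] := FlM _ It0'.
  have [ut0 Mu] := Ht0' _ ttau.
  (* With [u = s k - tau], the point [x + s k] is [x + u] shifted by the almost period [tau], and
     [H3] puts both in [outer I M]. *)
  exists (s k - tau) => _; split => //.
    rewrite -[X in `|X|](subrK t0) addrC (le_trans (ler_normD _ _))// lerD2l.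
    exact: le_trans (mx_norm_le_enorm _) ut0.
  move=> x Ix; have Mxu : outer I M (x + (s k - tau)) by rewrite addrC; exact: outerD.
  rewrite -{1}(subrK tau (s k)) addrA; apply: Ftau => //.
  by apply: outerD => //; case: ttau.
have [u Hu] := choice near_ball.
have [||p Vp] := @ultra_bounded_cauchy _ _ _ V u (`|t0| + r * l) VU _ (d / 2).
- by apply: filterS (s_infty (M + l)) => k /Hu[].
- by rewrite divr_gt0.
have Vp' : \forall k \near V, M + l <= enorm (s k) /\ `|p - u k| < d / 2.
  by apply: filterS2 (s_infty (M + l)) Vp => k.
have [j [/Hu[Muj _ Fj] pj]] := filter_ex Vp'.
exists j; apply: filterS Vp' => k [/Hu[Muk _ Fk] pk] x Ix.
have Iuj : I (x + u j) by rewrite addrC; case: (outerD _ _ Muj Ix).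
have Iuk : I (x + u k) by rewrite addrC; case: (outerD _ _ Muk Ix).
have Fjk : `|c *: F (x + u j) - c *: F (x + u k)| <= (e / 3)%:C.
  rewrite -scalerBr normrZ c1 mul1r; apply: Fd => //.
  rewrite opprD addrACA subrr add0r -(subrKA p) [ltRHS]splitr.
  rewrite (le_lt_trans (ler_normD _ _))//.
  by rewrite ltrD// distrC.
(* The chain is [F (x + s j)], [c *: F (x + u j)], [c *: F (x + u k)], [F (x + s k)]. *)
have -> : e = e / 3 + (e / 3 + e / 3) by field.
rewrite !rmorphD/= (le_trans (ler_distD (c *: F (x + u j)) _ _))// lerD ?Fj//.
rewrite (le_trans (ler_distD (c *: F (x + u k)) _ _))// lerD//.
by rewrite distrC Fk.
Qed.

(** Completeness gives pointwise limits on [D]; as [j] and the set of good [k] do not depend on [x],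
    the estimate is uniform. Off [D] nothing is claimed about [lim]. *)
Lemma cauchy_unif_limit (R : realType) (X T : Type)
    (Y : completeNormedModType R[i]) (D : set X) (V : set_system T)
    (VF : ProperFilter V) (f : T -> X -> Y) :
  (forall e : R, 0 < e -> exists j, \forall k \near V, forall x, D x ->
    `|f j x - f k x| <= e%:C) ->
  exists g : X -> Y, forall e : R, 0 < e -> \forall k \near V,
    forall x, D x -> `|g x - f k x| <= e%:C.
Proof.
move=> fC; exists (fun x => lim (f k x @[k --> V])) => e e0.
have fcvg x : D x -> cvg (f k x @[k --> V]).
  move=> Dx; apply: cauchy_cvg; apply: cauchy_exP => _ /gt0_complexE[d d0 ->].
  have [|j Vj] := fC (d / 2); first by rewrite divr_gt0.
  exists (f j x); rewrite /fmap/=; apply: filterS Vj => k /(_ _ Dx) fjk.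
  rewrite /= -ball_normE/= (le_lt_trans fjk)// ltcR.
  by rewrite ltr_pdivrMr// ltr_pMr// ltr1n.
have [|j Vj] := fC (e / 2); first by rewrite divr_gt0.
apply: filterS (Vj) => k fjk x Dx.
(* The Cauchy bound passes to the limit, up to an arbitrary slack [d]. *)
have gj : `|lim (f k0 x @[k0 --> V]) - f j x| <= (e / 2)%:C.
  apply/ler_addgt0Pr => _ /gt0_complexE[d d0 ->].
  have d0' : 0 < d%:C by rewrite ltcR.
  have [k1 [gk1 fk1]] := filter_ex
    (filterI (@cvgr_dist_le _ _ _ _ _ _ _ (fcvg x Dx) _ d0') Vj).
  rewrite (le_trans (ler_distD (f k1 x) _ _))// addrC lerD//.
  by rewrite distrC fk1.
rewrite [e]splitr rmorphD/= (le_trans (ler_distD (f j x) _ _))// lerD//.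
exact: fjk.
Qed.

Theorem theorem2p27 (R : realType) (n : nat) (n_gt0 : (0 < n)%N)
    (Y : completeNormedModType R[i]) (c : R[i]) (c1 : `|c| = 1)
    (I : set 'rV[R]_n) (I_neq0 : I !=set0) (I_closed : closed I)
    (I_sum : setsum I I = I)
    (H1 : forall l M : R, 0 < l -> 0 < M ->
       exists (t0 : 'rV[R]_n) (k : R), [/\ I t0, 0 < k &
         forall t, outer I (M + l) t ->
           exists2 t0', I t0' &
             forall t0'', (eball t0' l `&` I) t0'' ->
               (eball t0 (k * l) `&` outer I M) (t - t0'')])
    (H2 : exists2 L : R, 0 < L &
       forall k : nat, (0 < k)%N ->
         outer I (k%:R * L) `\` outer I (k.+1%:R * L) !=set0)
    (H3 : forall M : R, 0 < M -> setsum (outer I M) I `<=` outer I M)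
    (F : 'rV[R]_n -> Y) (F_uc : uniformly_continuous_on I F)
    (F_bounded : [bounded F t | t in I])
    (F_ap : asymptotically_Bohr_ap_type1 c I F) :
  asymptotically_Bohr_ap c I F.
Proof.
have c0 : c != 0 by rewrite -normr_gt0 c1.
have normcV (y : Y) : `|c^-1 *: y| = `|y| by rewrite normrZ normfV c1 invr1 mul1r.
have ID x y : I x -> I y -> I (x + y).
  by move=> Ix Iy; rewrite -I_sum; exists x => //; exists y.
have outerD M x y : 0 < M -> outer I M x -> I y -> outer I M (x + y).
  by move=> M0 Mx Iy; apply: H3 => //; exists x => //; exists y.
have Iunb r : exists2 t, I t & r <= `|t|.
  (* [N * L] exceeds [n * |r|]; the factor [n] pays for passing from the Euclidean to the sup norm,
     and the successor makes [N] positive as [H2] requires. *)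
  have [L L0 HL] := H2; pose N := (Num.truncn (`|n%:R * r| / L)).+1.
  have [t [[It Nt] _]] := HL N isT; exists t => //.
  rewrite -(ler_pM2l (x := n%:R)) ?ltr0n// (le_trans _ (enorm_le_mx_norm t))//.
  rewrite (le_trans _ Nt)// (le_trans (ler_norm _))// -ler_pdivrMr// ltW//.
  by rewrite truncnS_gt.
have invS_gt0 (k : nat) : 0 < k.+1%:R^-1 :> R by rewrite invr_gt0 ltr0n.
have [s Hs] := choice (fun k : nat =>
  enorm_unbounded_almost_period Iunb H3 F_ap k%:R (invS_gt0 k)).
have Is k : I (s k) by have [] := Hs k.
have [V [VU ooV]] := ultraFilterLemma eventually_filter.
have s_infty M : \forall k \near V, M <= enorm (s k).
  apply: ooV; apply: filterS (nbhs_infty_ger M) => k Mk.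
  by have [_ /(le_trans Mk)] := Hs k.
have FC := translates_cauchy c1 H1 H3 F_uc F_ap VU Is s_infty.
have [H HF] := cauchy_unif_limit (f := fun k x => F (x + s k)) ultra_proper FC.
have [F_cont F_type1] := F_ap.
(* All translates of [F] by points of [I] share its modulus of continuity on [I], and the uniform
   limit inherits it. *)
have GC : {within I, continuous (fun t => c^-1 *: H t)}.
  apply/subspace_continuousP => x Ix.
  apply/cvgrPdist_le => _ /gt0_complexE[e e0 ->].
  have e30 : 0 < e / 3 by rewrite divr_gt0.
  have [d d0 Fd] := unif_continuous_on_norm F_uc e30.
  apply: filterS (nbhsx_ballx x _ d0) => y; rewrite -ball_normE /= => xyd Iy.
  have [k HFk] := filter_ex (HF _ e30).
  rewrite -scalerBr normcV (_ : e = e / 3 + (e / 3 + e / 3)); last by field.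
  rewrite !rmorphD/= (le_trans (ler_distD (F (x + s k)) _ _))// lerD ?HFk//.
  rewrite (le_trans (ler_distD (F (y + s k)) _ _))// lerD//; last first.
    by rewrite distrC HFk.
  by apply: Fd; [exact: ID|exact: ID|rewrite opprD addrACA subrr addr0].
exists (fun t => c^-1 *: H t), (fun t => F t - c^-1 *: H t); split.
- split=> // e e0; have e30 : 0 < e / 3 by rewrite divr_gt0.
  have [l [M [l0 M0 FlM]]] := F_type1 _ e30; exists l => // t0 It0.
  have [tau ttau Ftau] := FlM _ It0; exists tau => // t It.
  have Itau : I tau by case: ttau.
  (* Since [k] is chosen after [M], [t + s k] lies in [outer I M] even when [t] is small, so the
     estimate for [tau] reaches every [t] in [I]. *)
  have [k [HFk Mk]] := filter_ex (filterI (HF _ e30) (s_infty M)).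
  have Mts : outer I M (t + s k) by rewrite addrC; exact: outerD.
  rewrite scalerA mulrC -scalerA -scalerBr normcV.
  rewrite (_ : e = e / 3 + (e / 3 + e / 3)); last by field.
  rewrite !rmorphD/= (le_trans (ler_distD (F (t + tau + s k)) _ _))// lerD//.
    by rewrite HFk//; exact: ID.
  rewrite (le_trans (ler_distD (c *: F (t + s k)) _ _))// lerD//.
    by rewrite addrAC Ftau//; exact: outerD.
  by rewrite -scalerBr normrZ c1 mul1r distrC HFk.
- move=> x; apply: cvgB; [exact: F_cont|exact: GC].
- apply/cvgrPdist_le => _ /gt0_complexE[e e0 ->].
  have e20 : 0 < e / 2 by rewrite divr_gt0.
  have oo_e : \forall k \near V, k.+1%:R^-1 <= e / 2 :> R.
    by apply: ooV; apply: filterS (near_infty_natSinv_lt (PosNum e20)) => k /ltW.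
  (* For one fixed [k], [F (t + s k)] is within [e / 2] of [H t] on [I], and of [c *: F t] beyond
     the radius [M] attached to [s k]. *)
  have [k [HFk ke]] := filter_ex (filterI (HF _ e20) oo_e).
  have [_ _ [M M0 FM]] := Hs k.
  exists M => // t /= Mt It; rewrite sub0r normrN.
  rewrite -[F t]scale1r -(mulVf c0) -scalerA -scalerBr normcV distrC.
  rewrite [e]splitr rmorphD/= (le_trans (ler_distD (F (t + s k)) _ _))// lerD ?HFk//.
  by rewrite (le_trans (FM _ _))// lecR.
- by move=> t _; rewrite addrC subrK.
Qed.
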